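(* Let $(\mathbb{K},[\cdot,\cdot])$ be a Krein space with fundamental symmetry $J$, and let $\mathbb{F}=\{(W_i,v_i):i\in I\}$ be a fusion frame for $\mathbb{K}$ such that each $W_i$ is either $J$-non-negative or $J$-negative. Let $I_+$ be the set of $i$ with $W_i$ $J$-non-negative, let $I_-$ be the set of $i$ with $W_i\ne\{0\}$ and $W_i$ $J$-negative, and let $M_\pm=\overline{\sum_{i\in I_\pm}W_i}$. Suppose that $M_\pm\cap M_\pm^{[\perp]}=\{0\}$ (for both signs) and that there exist constants $B_-\le A_-<0<A_+\le B_+$ such that $$A_{\pm}[f,f]\le\sum_{i\in I_\pm}v_i^2\,\big|[\pi_{W_i}J(f),f]\big|\le B_\pm[f,f]\qquad\text{for all } f\in M_\pm$$ (for both signs). Then $\mathbb{F}$ is a $J$-fusion frame for $\mathbb{K}$.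
   Context: $\langle f,g\rangle_J=[Jf,g]$ is the Hilbert space inner product of $\mathbb{K}$ and $\|\cdot\|_J$ its norm. For a closed subspace $W$, $\pi_W$ is the orthogonal projection onto $W$ with respect to $\langle\cdot,\cdot\rangle_J$. $M^{[\perp]}=\{g:[g,f]=0\ \forall f\in M\}$. A subspace $W$ is $J$-non-negative if $[f,f]\ge 0$ for all $f\in W$; $J$-negative if $[f,f]<0$ for all nonzero $f\in W$; uniformly $J$-positive (resp. uniformly $J$-negative) if there is $\alpha>0$ with $[f,f]\ge\alpha\|f\|_J^2$ (resp. $-[f,f]\ge\alpha\|f\|_J^2$) for all $f\in W$. Maximality is with respect to inclusion. A family $\{(W_i,v_i):i\in I\}$ of closed subspaces $W_i$ with weights $v_i>0$ is a fusion frame for $\mathbb{K}$ if there are $0<A\le B<\infty$ with $A\|f\|_J^2\le\sum_{i}v_i^2\|\pi_{W_i}f\|_J^2\le B\|f\|_J^2$ for all $f\in\mathbb{K}$; it is Bessel if the upper bound holds. Let $(\sum_{i\in I}\oplus W_i)_{\ell_2}$ be the Hilbert space of families $\{f_i\}$, $f_i\in W_i$, with $\sum\|f_i\|_J^2<\infty$. The synthesis operator is $T_{W,v}\{f_i\}=\sum_{i\in I}v_if_i$. Let $P_\pm$ be the orthogonal projection of this space onto $(\sum_{i\in I_\pm}\oplus W_i)_{\ell_2}$, and ${T_{W,v}}_\pm=T_{W,v}P_\pm$. A Bessel family (with each $W_i$ $J$-non-negative or $J$-negative) is a $J$-fusion frame for $\mathbb{K}$ if the range $R({T_{W,v}}_+)$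 is a maximal uniformly $J$-positive subspace of $\mathbb{K}$ and $R({T_{W,v}}_-)$ is a maximal uniformly $J$-negative subspace of $\mathbb{K}$. *)

(* Defs.v *)
From HB Require Import structures.
From mathcomp Require Import all_boot all_order all_algebra finmap.
From mathcomp Require Import sesquilinear.
From mathcomp Require Import complex.
From mathcomp Require Import all_classical all_reals all_analysis.
(* Not imported: its [sum] and [summable] would shadow other notions. *)
From mathcomp.analysis.showcase Require summability.

Set Implicit Arguments.
Unset Strict Implicit.
Unset Printing Implicit Defensive.

Import Order.TTheory GRing.Theory Num.Theory.
Import numFieldNormedType.Exports.

Local Open Scope classical_set_scope.
Local Open Scope complex_scope.
Local Open Scope ring_scope.

(* The indefinite inner product [f, g] is [form f g]: linear in [f], conjugate
   linear in [g] and Hermitian. *)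
Notation indefinite_form K :=
  {hermitian K for false & @Num.conj _} (only parsing).

Definition subspace (C : nzRingType) (K : lmodType C) (W : set K) :=
  submod_closed [pred f | f \in W].

Section Krein.
Context {R : realType} {K : completeNormedModType R[i]}.
Variable form : indefinite_form K.
Variable J : K -> K.

Definition fundamental_decomposition (Kp Km : set K) : Prop :=
  [/\ subspace Kp /\ subspace Km,
      (forall h, exists f g, [/\ Kp f, Km g & h = f + g]),
      (forall f g, Kp f -> Km g -> form f g = 0),
      (forall f, Kp f -> f != 0 -> 0 < form f f) &
      (forall g, Km g -> g != 0 -> form g g < 0)].

Definition fundamental_symmetry : Prop :=
  exists Kp Km, fundamental_decomposition Kp Km /\
    forall f g, Kp f -> Km g -> J (f + g) = f - g.

Definition ipJ (f g : K) : R[i] := form (J f) g.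

Definition normJ (f : K) : R := Num.sqrt (complex.Re (ipJ f f)).

(* The norm of [K], hence its topology, is the J-norm.  The requirement that
   both summands of the fundamental decomposition be Hilbert spaces is the
   completeness of [K] for this norm, which is part of the type of [K]. *)
Definition krein_space : Prop :=
  fundamental_symmetry /\ forall f : K, `|f| = (normJ f)%:C.

(* Since [form] is Hermitian, [f, f] is real; [sq f] is this real number. *)
Definition sq (f : K) : R := complex.Re (form f f).

Definition orthJ_compl (M : set K) : set K :=
  [set g | forall f, M f -> form g f = 0].

Definition J_nonnegative (W : set K) : Prop := forall f, W f -> 0 <= sq f.

Definition J_negative (W : set K) : Prop :=
  forall f, W f -> f != 0 -> sq f < 0.

Definition uniformly_J_positive (W : set K) : Prop :=
  exists2 alpha : R, 0 < alpha &
    forall f, W f -> alpha * normJ f ^+ 2 <= sq f.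

Definition uniformly_J_negative (W : set K) : Prop :=
  exists2 alpha : R, 0 < alpha &
    forall f, W f -> alpha * normJ f ^+ 2 <= - sq f.

Definition maximal_subspace (P : set K -> Prop) (W : set K) : Prop :=
  [/\ subspace W, P W &
      forall W', subspace W' -> P W' -> W `<=` W' -> W' = W].

(* Orthogonal projection onto [W] for the inner product [ipJ], defined by
   [piW W f] in [W] and [f - piW W f] orthogonal to [W]; the projection theorem
   gives existence when [W] is a closed subspace, and the default value 0 is
   then irrelevant. *)
Definition piW (W : set K) (f : K) : K :=
  xget 0 [set p | W p /\ forall g, W g -> ipJ (f - p) g = 0].

Section Families.
Context {I : choiceType}.
Variables (W : I -> set K) (v : I -> R).

Definition weighted_subspaces : Prop :=
  forall i, [/\ subspace (W i), closed (W i) & 0 < v i].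

Definition frame_sum (f : K) : \bar R :=
  (\esum_(i in [set: I]) (v i ^+ 2 * normJ (piW (W i) f) ^+ 2)%:E)%E.

Definition bessel_fusion : Prop :=
  weighted_subspaces /\
  exists B : R, forall f, (frame_sum f <= (B * normJ f ^+ 2)%:E)%E.

Definition fusion_frame : Prop :=
  weighted_subspaces /\
  exists A B : R, [/\ 0 < A, A <= B &
    forall f, ((A * normJ f ^+ 2)%:E <= frame_sum f
                                     <= (B * normJ f ^+ 2)%:E)%E].

Definition Iplus : set I := [set i | J_nonnegative (W i)].

Definition Iminus : set I :=
  [set i | W i <> [set 0] /\ J_negative (W i)].

Definition l2_sum : set (I -> K) :=
  [set f | (forall i, W i (f i)) /\
           (\esum_(i in [set: I]) (normJ (f i) ^+ 2)%:E < +oo)%E].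

(* [summability.sum] is the limit of the finite partial sums along the net of
   finite subsets of [I]. *)
Definition synthesis (f : I -> K) : K :=
  summability.sum (fun i => (v i)%:C *: f i).

(* The orthogonal projection of [l2_sum] onto the families indexed by [D],
   these being viewed as families vanishing off [D]. *)
Definition proj_l2 (D : set I) (f : I -> K) : I -> K := patch (fun=> 0) D f.

Definition synthesis_range (D : set I) : set K :=
  [set synthesis (proj_l2 D f) | f in l2_sum].

Definition J_fusion_frame : Prop :=
  [/\ bessel_fusion,
      (forall i, J_nonnegative (W i) \/ J_negative (W i)),
      maximal_subspace uniformly_J_positive (synthesis_range Iplus) &
      maximal_subspace uniformly_J_negative (synthesis_range Iminus)].

Definition sum_subspaces (D : set I) : set K :=
  [set x | exists (F : {fset I}) (f : I -> K),
     (forall i, i \in F -> D i /\ W i (f i)) /\ x = \sum_(i <- F) f i].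

Definition closed_sum (D : set I) : set K := closure (sum_subspaces D).

(* The norm on [R[i]] is [R[i]]-valued; its real part is the real modulus. *)
Definition signed_frame_sum (D : set I) (f : K) : \bar R :=
  (\esum_(i in D)
     (v i ^+ 2 * complex.Re `|form (piW (W i) (J f)) f|)%:E)%E.

End Families.
End Krein.

(* Main.v *)
Require Import Defs.
From mathcomp Require Import all_boot all_order all_algebra finmap.
From mathcomp Require Import sesquilinear complex.
From mathcomp Require Import all_classical all_reals all_analysis.
From mathcomp Require Import ring lra.
From mathcomp.analysis.showcase Require summability.

Import Order.TTheory GRing.Theory Num.Theory.
Import numFieldNormedType.Exports.

Local Open Scope classical_set_scope.
Local Open Scope complex_scope.
Local Open Scope ring_scope.

(* Let S_+ = T_+ T_+^* and let G = pi_{M_+} J restricted to M_+, so that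
   [f, g] = <G f, g> on M_+.  Since [pi_{W_i} J f, f] = |pi_{W_i} J f|^2 and
   pi_{W_i} J f = pi_{W_i} G f for W_i inside M_+, the hypothesis reads
   A_+ G <= G S_+ G <= B_+ G.  The upper bound gives G >= 0; the lower one and
   the Bessel bound B give A_+ <G f, f> <= B |G f|^2, which says that the
   spectrum of the injective operator G avoids ]0, A_+ / B[, hence G >= A_+ / B
   and M_+ is uniformly J-positive.  In particular G is onto M_+, so the lower
   bound becomes a lower frame bound for {W_i : i in I_+} in M_+, and
   R(T_+) = M_+.  The negative family is handled by replacing J with - J.
   Maximality follows from K = R(T) = M_+ + M_-.

   All this only uses the real inner product Re <f, g>_J: for complex subspaces
   it has the same orthogonal projections as <f, g>_J. *)

Set Implicit Arguments.
Unset Strict Implicit.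
Unset Printing Implicit Defensive.

(** * Real inner products that induce the norm, with squared distances in place of neighbourhoods *)

Record real_inner_product {R : realType} {K : completeNormedModType R[i]}
    (ip : K -> K -> R) : Prop := RealInnerProduct {
  ipC : forall x y, ip x y = ip y x;
  ipDl : forall x y z, ip (x + y) z = ip x z + ip y z;
  ipZl : forall a x y, ip (a%:C *: x) y = a * ip x y;
  ip_ge0 : forall x, 0 <= ip x x;
  ip_norm : forall x, `|x| = (Num.sqrt (ip x x))%:C }.

Section RealHilbert.
Context {R : realType} {K : completeNormedModType R[i]}.
Variable ip : K -> K -> R.
Hypothesis ipP : real_inner_product ip.

Definition real_subspace (M : set K) : Prop :=
  [/\ M 0, (forall x y, M x -> M y -> M (x + y)) &
      (forall a x, M x -> M (a%:C *: x))].

Definition real_linear (S : K -> K) : Prop :=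
  (forall x y, S (x + y) = S x + S y) /\
  (forall a x, S (a%:C *: x) = a%:C *: S x).

Lemma real_subspaceB M x y : real_subspace M -> M x -> M y -> M (x - y).
Proof.
move=> [_ MD MZ] Mx My; apply: MD => //.
by have := MZ (-1) _ My; rewrite rmorphN1 scaleN1r.
Qed.

Lemma real_linear0 S : real_linear S -> S 0 = 0.
Proof. by case=> _ SZ; have := SZ 0 0; rewrite rmorph0 !scale0r. Qed.

Lemma real_linearN S x : real_linear S -> S (- x) = - S x.
Proof. by case=> _ SZ; have := SZ (-1) x; rewrite rmorphN1 !scaleN1r. Qed.

Lemma real_linearB S x y : real_linear S -> S (x - y) = S x - S y.
Proof. by move=> SL; rewrite -(real_linearN _ SL) (proj1 SL). Qed.

Lemma ipNl x y : ip (- x) y = - ip x y.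
Proof. by have := ipZl ipP (-1) x y; rewrite rmorphN1 scaleN1r mulN1r. Qed.

Lemma ipBl x y z : ip (x - y) z = ip x z - ip y z.
Proof. by rewrite (ipDl ipP) ipNl. Qed.

Lemma ipDr x y z : ip x (y + z) = ip x y + ip x z.
Proof. by rewrite (ipC ipP) (ipDl ipP) !(ipC ipP _ x). Qed.

Lemma ipBr x y z : ip x (y - z) = ip x y - ip x z.
Proof. by rewrite (ipC ipP) ipBl !(ipC ipP _ x). Qed.

Lemma ipZr a x y : ip x (a%:C *: y) = a * ip x y.
Proof. by rewrite (ipC ipP) (ipZl ipP) (ipC ipP). Qed.

Lemma ip0l x : ip 0 x = 0.
Proof. by have := ipZl ipP 0 0 x; rewrite scaler0 mul0r. Qed.

Lemma ip_eq0 x : ip x x <= 0 -> x = 0.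
Proof.
move=> x0; apply/eqP; rewrite -normr_eq0 (ip_norm ipP).
suff -> : ip x x = 0 by rewrite sqrtr0.
by apply/eqP; rewrite eq_le x0 (ip_ge0 ipP).
Qed.

Lemma ip_suml (I : Type) (r : seq I) (F : I -> K) x :
  ip (\sum_(i <- r) F i) x = \sum_(i <- r) ip (F i) x.
Proof.
elim: r => [|i r IH]; first by rewrite !big_nil ip0l.
by rewrite !big_cons (ipDl ipP) IH.
Qed.

Lemma ip_sqD x y : ip (x + y) (x + y) = ip x x + 2 * ip x y + ip y y.
Proof. by rewrite !(ipDl ipP) !ipDr (ipC ipP y x); ring. Qed.

Lemma ip_sqB x y : ip (x - y) (x - y) = ip x x - 2 * ip x y + ip y y.
Proof. by rewrite !ipBl !ipBr (ipC ipP y x); ring. Qed.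

Lemma dist_lt x y e : 0 < e -> ip (x - y) (x - y) < e ^+ 2 -> `|x - y| < e%:C.
Proof.
move=> e0 xy; rewrite (ip_norm ipP) ltcR.
rewrite -(@ltr_pXn2r _ 2) ?nnegrE ?sqrtr_ge0 ?(ltW e0)//.
by rewrite sqr_sqrtr ?(ip_ge0 ipP).
Qed.

Lemma lt_dist x y e : 0 < e -> `|x - y| < e%:C -> ip (x - y) (x - y) < e ^+ 2.
Proof.
move=> e0; rewrite (ip_norm ipP) ltcR => h.
rewrite -(sqr_sqrtr (ip_ge0 ipP (x - y))).
by rewrite ltr_pXn2r ?nnegrE ?sqrtr_ge0// ltW.
Qed.

Lemma complex_gt0 (e : R[i]) : 0 < e -> exists2 r : R, 0 < r & e = r%:C.
Proof.
case: e => a b; rewrite ltcE/= => /andP[/eqP b0 a0].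
by exists a => //; rewrite b0.
Qed.

Lemma closure_dist M x : closure M x <->
  forall e, 0 < e -> exists2 y, M y & ip (x - y) (x - y) < e.
Proof.
split=> [h e e0|h B /nbhs_ballP[e /complex_gt0[r r0 ->] eB]].
  have s0 : 0 < (Num.sqrt e)%:C :> R[i] by rewrite ltcR sqrtr_gt0.
  have [y [My]] := h _ (nbhsx_ballx x _ s0).
  rewrite -ball_normE /= => d; exists y => //.
  by rewrite -(sqr_sqrtr (ltW e0)); apply: lt_dist; rewrite ?sqrtr_gt0.
have [y My xy] := h (r ^+ 2) (exprn_gt0 _ r0).
by exists y; split => //; apply: eB; rewrite -ball_normE /=; apply: dist_lt.
Qed.

Lemma cvg_dist (T : Type) (F : set_system T) (FF : Filter F) (f : T -> K) l :
  (f @ F --> l) <->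
  forall e, 0 < e -> \forall t \near F, ip (l - f t) (l - f t) < e.
Proof.
split=> [/cvgrPdist_lt h e e0|h].
  have s0 : 0 < (Num.sqrt e)%:C :> R[i] by rewrite ltcR sqrtr_gt0.
  apply: filterS (h _ s0) => t d.
  by rewrite -(sqr_sqrtr (ltW e0)); apply: lt_dist; rewrite ?sqrtr_gt0.
apply/cvgrPdist_lt => e /complex_gt0[r r0 ->].
by apply: filterS (h _ (exprn_gt0 2 r0)) => t; apply: dist_lt.
Qed.

Lemma cauchy_cvg_dist (T : Type) (F : set_system T) (FF : ProperFilter F)
    (f : T -> K) :
  (forall e, 0 < e -> exists x, \forall t \near F, ip (x - f t) (x - f t) < e) ->
  exists l : K, f @ F --> l.
Proof.
move=> h; suff /cauchy_cvg fF : cauchy (f @ F) by exists (lim (f @ F)).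
apply: cauchy_exP => e /complex_gt0[r r0 ->].
have [x hx] := h _ (exprn_gt0 2 r0); exists x.
by apply: filterS hx => t; rewrite /= -ball_normE /=; apply: dist_lt.
Qed.

(* Completeness for nested sets [Q e] whose diameter tends to 0 with [e]. *)
Lemma shrinking_sets_limit (Q : R -> set K) :
  (forall e, 0 < e -> exists x, Q e x) ->
  (forall e e', e <= e' -> Q e `<=` Q e') ->
  (forall e, 0 < e -> exists2 d, 0 < d &
     forall x y, Q d x -> Q d y -> ip (x - y) (x - y) < e) ->
  exists l, forall e, 0 < e -> exists2 x, Q e x & ip (l - x) (l - x) < e.
Proof.
move=> Qne Qmono Qsmall.
pose F := filter_from [set e | 0 < e] Q.
have FF : ProperFilter F.
  apply: filter_from_proper => [|e /Qne[x Qx]]; last by exists x.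
  apply: filter_from_filter; first by exists 1; rewrite /= ltr01.
  move=> d e d0 e0; exists (Num.min d e); first by rewrite /= lt_min; apply/andP.
  by move=> x Qx; split; apply: Qmono Qx; rewrite ge_min lexx ?orbT.
have FQ e : 0 < e -> F (Q e) by exists e.
have [|l /cvg_dist Fl] := @cauchy_cvg_dist _ F FF id.
  move=> e /Qsmall[d d0 dQ]; have [x Qx] := Qne _ d0; exists x.
  by apply: filterS (FQ _ d0) => y; apply: dQ.
exists l => e e0.
have [x [Qx lx]] := filter_ex (filterI (FQ _ e0) (Fl _ e0)).
by exists x.
Qed.

Lemma closure_real_subspace M : real_subspace M -> real_subspace (closure M).
Proof.
move=> [M0 MD MZ]; split; first exact: subset_closure.
- move=> x y /closure_dist hx /closure_dist hy; apply/closure_dist => e e0.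
  (* As |u + v|^2 <= 2 |u|^2 + 2 |v|^2, two errors below e / 4 suffice. *)
  have e4 : 0 < e / 4 by lra.
  have [x' Mx' dx] := hx _ e4; have [y' My' dy] := hy _ e4.
  exists (x' + y'); first exact: MD.
  rewrite opprD addrACA.
  have := ip_ge0 ipP ((x - x') - (y - y')).
  by rewrite (ip_sqB (x - x')) (ip_sqD (x - x')); lra.
- move=> a x /closure_dist hx; apply/closure_dist => e e0.
  have a1 : 0 < a ^+ 2 + 1 by rewrite ltr_wpDl ?sqr_ge0.
  have [x' Mx' dx] := hx (e / (a ^+ 2 + 1)) (divr_gt0 e0 a1).
  exists (a%:C *: x'); first exact: MZ.
  rewrite -scalerBr (ipZl ipP) ipZr mulrA -expr2.
  rewrite ltr_pdivlMr // in dx.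
  by have := ip_ge0 ipP (x - x'); nra.
Qed.

(** * The Cauchy-Schwarz inequality and projections onto closed subspaces *)

(** Semidefiniteness on [M] is enough, so that the lemma serves both for the inner product and for
    the indefinite form on a subspace where it is nonnegative. *)
Lemma cauchy_schwarz (b : K -> K -> R) (M : set K) x y : real_subspace M ->
  (forall x y, b x y = b y x) ->
  (forall x y z, b (x + y) z = b x z + b y z) ->
  (forall a x y, b (a%:C *: x) y = a * b x y) ->
  (forall x, M x -> 0 <= b x x) ->
  M x -> M y -> b x y ^+ 2 <= b x x * b y y.
Proof.
move=> [_ MD MZ] bC bD bZ b0 Mx My.
have bDr u v w : b u (v + w) = b u v + b u w by rewrite bC bD !(bC _ u).
have bZr a u v : b u (a%:C *: v) = a * b u v by rewrite bC bZ bC.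
have q s t : 0 <= s ^+ 2 * b x x + 2 * s * t * b x y + t ^+ 2 * b y y.
  have := b0 (s%:C *: x + t%:C *: y) (MD _ _ (MZ _ _ Mx) (MZ _ _ My)).
  by rewrite !bD !bDr !bZ !bZr (bC y x); congr (_ <= _); ring.
have := b0 _ Mx; have := b0 _ My.
have [y0|y0] := ltP 0 (b y y).
  (* This value of [q] is b(y,y) (b(x,x) b(y,y) - b(x,y)^2). *)
  by have := q (b y y) (- b x y); nra.
move=> y1 _; have {y0 y1} y0 : b y y = 0 by apply/eqP; rewrite eq_le y0.
have [-> | xy0] := eqVneq (b x y) 0; first by rewrite y0 expr2 !mul0r mulr0.
(* Since b(y,y) = 0, this [t] would make [q 1 t] equal to -1. *)
pose t := - (b x x + 1) / (2 * b x y).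
have txy : t * b x y = - (b x x + 1) / 2 by rewrite /t; field; rewrite xy0.
by have := q 1 t; rewrite y0; lra.
Qed.

Lemma ip_cauchy_schwarz x y : ip x y ^+ 2 <= ip x x * ip y y.
Proof.
by apply: (@cauchy_schwarz ip setT) => //;
  [exact: ipC|exact: ipDl|exact: ipZl|move=> z _; exact: ip_ge0].
Qed.

Lemma le0_eps (x C : R) : 0 <= C -> (forall e, 0 < e -> x <= e * C) -> x <= 0.
Proof.
move=> C0 h; rewrite leNgt; apply/negP => x0.
have C1 : 0 < 2 * (C + 1) by lra.
have := h _ (divr_gt0 x0 C1); rewrite mulrAC ler_pdivlMr//; nra.
Qed.

Lemma closed_dist M x : closed M ->
  (forall e, 0 < e -> exists2 y, M y & ip (x - y) (x - y) < e) -> M x.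
Proof. by move=> Mcl h; rewrite (proj1 (closure_id M) Mcl); apply/closure_dist. Qed.

Lemma sub_subl (f x y : K) : (f - y) - (f - x) = x - y.
Proof. by rewrite opprB [LHS]addrC addrA subrK. Qed.

(** Near-minimisers of the distance to [f] are close to each other by the parallelogram law, so they
    converge. Orthogonality is then read off from near-minimisers close to the limit. *)
Lemma projection_exists M f : real_subspace M -> closed M ->
  exists p, M p /\ forall g, M g -> ip (f - p) g = 0.
Proof.
move=> Msub Mcl; have [M0 MD MZ] := Msub.
pose D w := ip (f - w) (f - w); pose m := inf [set D w | w in M].
have Dinf : has_inf [set D w | w in M].
  by split; [exists (D 0), 0|exists 0 => _ [w _ <-]; apply: ip_ge0].
have mD w : M w -> m <= D w by move=> Mw; apply: (ge_inf (proj2 Dinf)); exists w.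
pose Q e := [set w | M w /\ D w < m + e].
have [|||p hp] := @shrinking_sets_limit Q.
- by move=> e /inf_adherent => /(_ _ Dinf)[_ [w Mw <-] Dw]; exists w.
- by move=> e e' ee' w [Mw Dw]; split => //; rewrite (lt_le_trans Dw)// lerD2l.
(* |x - y|^2 = 2 D x + 2 D y - 4 D ((x + y) / 2) < 4 (e / 4). *)
- move=> e e0; exists (e / 4) => [|x y [Mx Dx] [My Dy]]; first lra.
  have := mD _ (MZ (1 / 2) _ (MD _ _ Mx My)); rewrite /D.
  have -> : f - (1 / 2)%:C *: (x + y) = (1 / 2)%:C *: ((f - x) + (f - y)).
    rewrite addrACA -opprD scalerBr; congr (_ - _).
    rewrite scalerDr -scalerDl -rmorphD /= (_ : 1 / 2 + 1 / 2 = 1); last by field.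
    by rewrite scale1r.
  rewrite (ipZl ipP) ipZr (ip_sqD (f - x)).
  rewrite -(sub_subl f x).
  rewrite (ip_sqB (f - y)) (ipC ipP (f - y)); rewrite /D in Dx Dy; lra.
exists p.
have Mp : M p.
  by apply: (closed_dist Mcl) => e /hp[w [Mw _] pw]; exists w.
split=> // g Mg; apply/eqP; rewrite -sqrf_eq0 eq_le sqr_ge0 andbT.
(* For a near-minimiser w, both <f - w, g> and <p - w, g> have squares at most e |g|^2, so their
   difference <f - p, g> has square at most 4 e |g|^2. *)
apply: (@le0_eps _ (4 * ip g g)) => [|e e0].
  by rewrite mulr_ge0// (ip_ge0 ipP).
have [w [Mw Dw] pw] := hp e e0.
(* Moving [w] in the direction [g] decreases [D w] by less than [e]. *)
have wg : ip (f - w) g ^+ 2 <= e * ip g g.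
  have [g0|g0] := ltP 0 (ip g g); last first.
    by rewrite (ip_eq0 g0) (ipC ipP) !ip0l expr2 !mulr0.
  pose t := ip (f - w) g / ip g g.
  have := mD _ (MD _ _ Mw (MZ t _ Mg)); rewrite /D opprD addrA (ip_sqB (f - w)).
  rewrite (ipZl ipP) !ipZr.
  have tg : t * ip g g = ip (f - w) g by rewrite divfK// gt_eqF.
  by rewrite /D in Dw; rewrite -tg; nra.
have := ip_cauchy_schwarz (p - w) g.
have := ip_ge0 ipP g.
have -> : ip (f - p) g = ip (f - w) g - ip (p - w) g by rewrite -ipBl opprB addrA subrK.
set a := ip (f - w) g in wg *; set b := ip (p - w) g.
have : 0 <= (a + b) ^+ 2 by exact: sqr_ge0.
by nra.
Qed.

(** * Coercive operators *)

(** Cauchy-Schwarz gives c |x|^2 <= |S x| |x|. This lower bound is what closes the range in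
    [coercive_onto]. *)
Lemma coercive_injective (S : K -> K) c x : 0 < c ->
  c * ip x x <= ip (S x) x -> c ^+ 2 * ip x x <= ip (S x) (S x).
Proof.
move=> c0 h; have := ip_cauchy_schwarz (S x) x.
have := ip_ge0 ipP x; rewrite le_eqVlt => /predU1P[<-|x0].
  by move=> _; rewrite mulr0 (ip_ge0 ipP).
move=> xS; rewrite -(ler_pM2r x0); apply: le_trans xS.
rewrite -mulrA -expr2 -exprMn ler_pXn2r// nnegrE.
  by rewrite mulr_ge0 ?ltW.
by apply: le_trans h; rewrite mulr_ge0 ?ltW.
Qed.

(** The Lax-Milgram argument: the range is closed, and coercivity applied to the component of [f]
    orthogonal to the range shows that it vanishes. *)
Lemma coercive_onto M S C c : real_subspace M -> closed M -> real_linear S ->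
  (forall x, M x -> M (S x)) -> 0 < c -> 0 <= C ->
  (forall x, M x -> ip (S x) (S x) <= C * ip x x) ->
  (forall x, M x -> c * ip x x <= ip (S x) x) ->
  forall f, M f -> exists2 x, M x & S x = f.
Proof.
move=> Msub Mcl SL SM c0 C0 SC Sc f Mf; have [M0 MD MZ] := Msub.
pose SM' := [set S x | x in M].
have SMsub : real_subspace SM'.
  split; first by exists 0 => //; rewrite real_linear0.
    by move=> _ _ [x Mx <-] [y My <-]; exists (x + y); [exact: MD|exact: (proj1 SL)].
  by move=> a _ [x Mx <-]; exists (a%:C *: x); [exact: MZ|exact: (proj2 SL)].
have SMcl : closed SM'.
  rewrite closure_id; apply/seteqP; split=> [|y /closure_dist yS].
    exact: subset_closure.
  (* Approximate preimages of [y], which shrink to a point by the lower bound on |S x|. *)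
  pose Q e := [set x | M x /\ ip (y - S x) (y - S x) < e].
  have [|||x hx] := @shrinking_sets_limit Q.
  - by move=> e /yS[_ [x Mx <-] xe]; exists x.
  - by move=> e e' ee' x [Mx xe]; split => //; apply: lt_le_trans ee'.
  - move=> e e0; have c2 : 0 < c ^+ 2 by rewrite exprn_gt0.
    (* This gives |S u - S w|^2 < c^2 e, hence |u - w|^2 < e. *)
    exists (c ^+ 2 * e / 4) => [|u w [Mu ue] [Mw we]].
      by rewrite divr_gt0// mulr_gt0.
    have Muw := real_subspaceB Msub Mu Mw.
    have := coercive_injective c0 (Sc _ Muw).
    rewrite (real_linearB _ _ SL) -(ltr_pM2l c2).
    rewrite -(sub_subl y (S u)).
    have := ip_ge0 ipP ((y - S w) + (y - S u)).
    by rewrite (ip_sqB (y - S w)) (ip_sqD (y - S w)); lra.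
  have Mx : M x by apply: (closed_dist Mcl) => e /hx[w [Mw _] xw]; exists w.
  exists x => //; apply/esym/eqP; rewrite -subr_eq0; apply/eqP/ip_eq0.
  (* |y - S x|^2 <= 2 |y - S w|^2 + 2 |S x - S w|^2 <= 2 e + 2 C e. *)
  apply: (@le0_eps _ (2 * C + 2)) => [|e e0]; first lra.
  have [w [Mw yw] xw] := hx e e0.
  have := SC _ (real_subspaceB Msub Mx Mw); rewrite (real_linearB _ _ SL).
  rewrite (_ : y - S x = (y - S w) - (S x - S w)); last first.
    by rewrite opprB addrA subrK.
  have := ip_ge0 ipP ((y - S w) + (S x - S w)).
  have : C * ip (x - w) (x - w) <= C * e by rewrite ler_wpM2l// ltW.
  by rewrite (ip_sqB (y - S w)) (ip_sqD (y - S w)); lra.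
(* [S x] is the projection of [f] onto the range, so [f - S x] is orthogonal to its own image under
   [S]. *)
have [_ [[x Mx <-] hx]] := projection_exists f SMsub SMcl.
exists x => //; apply/esym/eqP; rewrite -subr_eq0; apply/eqP/ip_eq0.
have Mfx : M (f - S x) by apply: real_subspaceB => //; exact: SM.
have := Sc _ Mfx.
rewrite (ipC ipP (S _)) (hx (S _)); last by exists (f - S x).
by rewrite pmulr_rle0.
Qed.

End RealHilbert.

(* Bessel families of projections: synthesis and frame operators *)
#[local] Existing Instance summability.totally_filter.

(** One identity carries both self-adjointness and idempotence, without naming the range. *)
Definition orthogonal_projection {R : realType} {K : completeNormedModType R[i]}
    (ip : K -> K -> R) (P : K -> K) : Prop :=
  real_linear P /\ forall x y, ip (P x) y = ip (P x) (P y).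

Section Synthesis.
Context {R : realType} {K : completeNormedModType R[i]}.
Variable ip : K -> K -> R.
Hypothesis ipP : real_inner_product ip.
Context {I : choiceType}.
Variables (v : I -> R) (P : I -> K -> K) (B : R).
Hypothesis PP : forall i, orthogonal_projection ip (P i).

Definition frame_partial (f : K) (F : {fset I}) : R :=
  \sum_(i <- F) v i ^+ 2 * ip (P i f) (P i f).

Hypothesis B0 : 0 < B.
Hypothesis bessel : forall f F, frame_partial f F <= B * ip f f.

(** An element of the l2 sum of the ranges of the [P i], of squared norm at most [C]. *)
Definition coefficients (g : I -> K) (C : R) : Prop :=
  (forall i, P i (g i) = g i) /\
  forall F : {fset I}, \sum_(i <- F) ip (g i) (g i) <= C.

Let fin (g : I -> K) (F : {fset I}) : K := \sum_(i <- F) (v i)%:C *: g i.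

Lemma projectionC Q x y : orthogonal_projection ip Q -> ip (Q x) y = ip x (Q y).
Proof. by move=> [_ QQ]; rewrite QQ (ipC ipP) -QQ (ipC ipP). Qed.

Lemma projection_idem Q x : orthogonal_projection ip Q -> Q (Q x) = Q x.
Proof.
move=> QP; apply/eqP; rewrite -subr_eq0; apply/eqP/(ip_eq0 ipP).
by rewrite (ipBl ipP) (projectionC _ _ QP) -(proj2 QP) subrr.
Qed.

Lemma big_fsetU_sub (V : nmodType) (F0 F : {fset I}) (h : I -> V) :
  (F0 `<=` F)%fset ->
  \sum_(i <- F) h i = \sum_(i <- F0) h i + \sum_(i <- (F `\` F0)%fset) h i.
Proof.
move=> /fsubsetP sF; rewrite -big_cat; apply: perm_big; apply: uniq_perm.
- exact: fset_uniq.
- rewrite cat_uniq !fset_uniq andbT /=; apply/hasPn => i.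
  by rewrite in_fsetD => /andP[].
- move=> i; rewrite mem_cat in_fsetD.
  by case: (boolP (i \in F0)) => //= /sF.
Qed.

(** Duality with the Bessel bound: the finite sum G has |G|^2 equal to the sum of v_i <g_i, P_i G>,
    and 2 B v_i <g_i, P_i G> <= B^2 |g_i|^2 + v_i^2 |P_i G|^2. After summation [bessel] at G absorbs
    the last terms. *)
Lemma fin_bound g C F : coefficients g C ->
  ip (fin g F) (fin g F) <= B * \sum_(i <- F) ip (g i) (g i).
Proof.
move=> [Pg _]; set G := fin g F; set X := \sum_(i <- F) _.
have GE : ip G G = \sum_(i <- F) v i * ip (g i) (P i G).
  rewrite {1}/G /fin (ip_suml ipP); apply: eq_bigr => i _.
  by rewrite (ipZl ipP) -(projectionC _ _ (PP i)) Pg.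
have : 2 * B * ip G G <= B ^+ 2 * X + frame_partial G F.
  rewrite GE /X /frame_partial !mulr_sumr -big_split /=; apply: ler_sum => i _.
  have := ip_ge0 ipP (B%:C *: g i - (v i)%:C *: P i G).
  by rewrite (ip_sqB ipP (B%:C *: g i)) !(ipZl ipP) !(ipZr ipP); lra.
have := bessel G F => h1 h2.
by rewrite -(ler_pM2l B0); nra.
Qed.

Let partial_sumE g F :
  summability.partial_sum (fun i => (v i)%:C *: g i) F = fin g F.
Proof. by rewrite /summability.partial_sum /fin big_seq_fsetE. Qed.

(** Cauchy criterion: once the sum of |g_i|^2 over [F0] is within e / B of its supremum, [fin_bound]
    on the tail keeps all later partial sums within squared distance e. *)
Lemma synthesis_cvg g C : coefficients g C ->
  summability.partial_sum (fun i => (v i)%:C *: g i) @ summability.totally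
    --> synthesis v g.
Proof.
move=> gC; suff [l hl] : exists l : K,
    summability.partial_sum (fun i => (v i)%:C *: g i) @ summability.totally --> l.
  rewrite /synthesis /summability.sum.
  by rewrite (cvg_lim (@norm_hausdorff _ _) hl).
apply: (cauchy_cvg_dist ipP) => e e0.
pose X (F : {fset I}) := \sum_(i <- F) ip (g i) (g i).
have Xsup : has_sup (range X).
  split; first by exists (X fset0), fset0.
  by exists C => _ [F _ <-]; apply: (proj2 gC).
have [_ [F0 _ <-] XF0] := sup_adherent (divr_gt0 e0 B0) Xsup.
exists (fin g F0); exists F0 => // F /= F0F.
rewrite partial_sumE /fin (big_fsetU_sub _ F0F) opprD addrA subrr sub0r.
rewrite (ipNl ipP) (ipC ipP) (ipNl ipP) opprK.
apply: le_lt_trans (fin_bound _ gC) _.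
have : X F <= sup (range X) by apply: (ub_le_sup (proj2 Xsup)); exists F.
rewrite /X (big_fsetU_sub _ F0F) => h.
by rewrite -ltr_pdivlMl// mulrC; rewrite /X in XF0; lra.
Qed.

(** Prescribing [F0] lets one finite set serve both for convergence and for comparison with a given
    partial sum. *)
Lemma synthesis_near g C F0 e : coefficients g C -> 0 < e ->
  exists F : {fset I}, (F0 `<=` F)%fset /\
    ip (synthesis v g - fin g F) (synthesis v g - fin g F) < e.
Proof.
move=> /synthesis_cvg /(cvg_dist ipP) h /h[F1 _ hF1].
exists (F0 `|` F1)%fset; split; first exact: fsubsetUl.
have := hF1 _ (fsubsetUr F0 F1).
by rewrite /= partial_sumE.
Qed.

Lemma synthesisD g h C D : coefficients g C -> coefficients h D ->
  synthesis v (fun i => g i + h i) = synthesis v g + synthesis v h.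
Proof.
move=> /synthesis_cvg gl /synthesis_cvg hl.
apply: (cvg_lim (@norm_hausdorff _ _)).
rewrite (_ : summability.partial_sum _ =
    summability.partial_sum (fun i => (v i)%:C *: g i) \+
    summability.partial_sum (fun i => (v i)%:C *: h i)); last first.
  apply/funext => F; rewrite /= !partial_sumE /fin -big_split.
  by apply: eq_bigr => i _; rewrite scalerDr.
exact: cvgD.
Qed.

Lemma synthesisZ a g C : coefficients g C ->
  synthesis v (fun i => a%:C *: g i) = a%:C *: synthesis v g.
Proof.
move=> /synthesis_cvg gl.
apply: (cvg_lim (@norm_hausdorff _ _)).
rewrite (_ : summability.partial_sum _ =
    a%:C \*: summability.partial_sum (fun i => (v i)%:C *: g i)); last first.
  apply/funext => F; rewrite /= !partial_sumE /fin scaler_sumr.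
  by apply: eq_bigr => i _; rewrite !scalerA mulrC.
exact: cvgZr.
Qed.

(** The factor 2 comes from |x + y|^2 <= 2 |x|^2 + 2 |y|^2; any finite bound serves in
    [coercive_onto]. *)
Lemma synthesis_bound g C : coefficients g C ->
  ip (synthesis v g) (synthesis v g) <= 2 * B * C.
Proof.
move=> gC; rewrite -subr_le0; apply: (@le0_eps _ _ 2) => // e e0.
have [F [_ hF]] := synthesis_near fset0 gC e0.
have h1 := fin_bound F gC; have h2 := ler_wpM2l (ltW B0) (proj2 gC F).
have := ip_ge0 ipP ((synthesis v g - fin g F) - fin g F).
have := ip_sqD ipP (synthesis v g - fin g F) (fin g F).
rewrite (ip_sqB ipP (synthesis v g - fin g F)) subrK; lra.
Qed.

Lemma synthesis_closed M g C : coefficients g C -> real_subspace M ->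
  closed M -> (forall i, M (g i)) -> M (synthesis v g).
Proof.
move=> gC [M0 MD MZ] Mcl Mg; apply: (closed_dist ipP Mcl) => e e0.
have [F [_ hF]] := synthesis_near fset0 gC e0.
exists (fin g F) => //; rewrite /fin.
by elim/big_ind : _ => // i _; apply: MZ.
Qed.

(** Synthesis composed with its adjoint, which sends x to the family of v_i P_i x. *)
Definition frame_operator (x : K) : K :=
  synthesis v (fun i => (v i)%:C *: P i x).

Lemma analysis_coefficients x :
  coefficients (fun i => (v i)%:C *: P i x) (B * ip x x).
Proof.
split=> [i|F]; first by rewrite (proj2 (proj1 (PP i))) projection_idem.
apply: le_trans (bessel x F); rewrite le_eqVlt; apply/orP; left; apply/eqP.
by apply: eq_bigr => i _; rewrite (ipZl ipP) (ipZr ipP) mulrA expr2.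
Qed.

Lemma frame_operator_linear : real_linear frame_operator.
Proof.
split=> [x y|a x]; rewrite /frame_operator.
  rewrite -(synthesisD (analysis_coefficients x) (analysis_coefficients y)).
  by congr synthesis; apply/funext => i; rewrite (proj1 (proj1 (PP i))) scalerDr.
rewrite -(synthesisZ _ (analysis_coefficients x)).
congr synthesis; apply/funext => i; rewrite (proj2 (proj1 (PP i))).
by rewrite !scalerA mulrC.
Qed.

(** The partial sums increase to <S x, x>. A finite set containing [F] that nearly computes S x
    gives the bound up to an error <d, x>. *)
Lemma frame_partial_le x F : frame_partial x F <= ip (frame_operator x) x.
Proof.
rewrite -subr_le0; apply: (@le0_eps _ _ (1 + ip x x)).
  by rewrite addr_ge0// (ip_ge0 ipP).
move=> e e0.
have [G [FG hG]] := synthesis_near F (analysis_coefficients x) (exprn_gt0 2 e0).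
have GE : ip (fin (fun i => (v i)%:C *: P i x) G) x = frame_partial x G.
  rewrite /fin (ip_suml ipP); apply: eq_bigr => i _.
  by rewrite !(ipZl ipP) mulrA -expr2 (proj2 (PP i)).
have FGle : frame_partial x F <= frame_partial x G.
  rewrite /frame_partial (big_fsetU_sub _ FG) lerDl; apply: sumr_ge0 => i _.
  by rewrite mulr_ge0 ?sqr_ge0// (ip_ge0 ipP).
rewrite -/(frame_operator x) in hG; set d := (_ - _) in hG.
have -> : ip (frame_operator x) x = ip d x + frame_partial x G.
  by rewrite -GE -(ipDl ipP) subrK.
(* With |d|^2 < e^2, this yields -2 <d, x> < e (1 + |x|^2). *)
have := ip_ge0 ipP (d + e%:C *: x).
rewrite (ip_sqD ipP d) (ipZr ipP) (ipZr ipP) (ipZl ipP) => h.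
have := ip_ge0 ipP x => x0.
have : e * (- 2 * ip d x) <= e * (e * (1 + ip x x)) by nra.
rewrite ler_pM2l//; nra.
Qed.

(** The frame operator is coercive on [M], hence onto, and a preimage x of [f] provides the
    coefficients v_i P_i x. Quantifying over [t] bounds the supremum of the partial sums from below
    without forming it. *)
Lemma frame_synthesis_onto M c : real_subspace M -> closed M ->
  (forall i x, M (P i x)) -> 0 < c ->
  (forall x t, M x -> (forall F, frame_partial x F <= t) -> c * ip x x <= t) ->
  forall f, M f -> exists g C, coefficients g C /\ synthesis v g = f.
Proof.
move=> Msub Mcl MP c0 low f Mf.
have [||||x _ <-] := @coercive_onto _ _ ip ipP M frame_operator
  (2 * B * B) c Msub Mcl frame_operator_linear _ c0 _ _ _ f Mf.
- move=> x _; apply: (synthesis_closed (analysis_coefficients x) Msub Mcl) => i.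
  by case: Msub => _ _ MZ; apply/MZ/MP.
- by rewrite !mulr_ge0// ltW.
- by move=> x _; have := synthesis_bound (analysis_coefficients x); rewrite mulrA.
- by move=> x Mx; apply: low => // F; apply: frame_partial_le.
by exists (fun i => (v i)%:C *: P i x), (B * ip x x); split=> //;
  apply: analysis_coefficients.
Qed.

End Synthesis.

(** * The Gram operator of the indefinite form on a closed subspace *)

Section GramOperator.
Context {R : realType} {K : completeNormedModType R[i]}.
Variable ip : K -> K -> R.
Hypothesis ipP : real_inner_product ip.

(** Orthogonality determines [Q x] within [M]; sums and multiples satisfy the same condition, whence
    linearity. *)
Lemma best_approximation_projection M Q : real_subspace M ->
  (forall x, M (Q x)) -> (forall x y, M y -> ip (x - Q x) y = 0) ->
  orthogonal_projection ip Q.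
Proof.
move=> Msub MQ Qort; have [M0 MD MZ] := Msub.
have Quniq x p : M p -> (forall y, M y -> ip (x - p) y = 0) -> Q x = p.
  move=> Mp hp; apply/eqP; rewrite -subr_eq0; apply/eqP/(ip_eq0 ipP).
  have MQp : M (Q x - p) by apply: real_subspaceB.
  rewrite -{1}(sub_subl x) (ipBl ipP) Qort// hp// subrr.
split; first split.
- move=> x y; apply: Quniq => [|z Mz]; first exact: MD.
  by rewrite opprD addrACA (ipDl ipP) !Qort// addr0.
- move=> a x; apply: Quniq => [|z Mz]; first exact: MZ.
  by rewrite -scalerBr (ipZl ipP) Qort// mulr0.
- move=> x y; apply/eqP; rewrite -subr_eq0 -(ipBr ipP) (ipC ipP).
  by rewrite Qort.
Qed.

Lemma projection_function M : real_subspace M -> closed M ->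
  exists Q, (forall x, M (Q x)) /\ forall x y, M y -> ip (x - Q x) y = 0.
Proof.
move=> Msub Mcl.
have /choice[Q hQ] := fun x => projection_exists ipP x Msub Mcl.
by exists Q; split=> x; [exact: (proj1 (hQ x))|exact: (proj2 (hQ x))].
Qed.

Variable J : K -> K.
Hypothesis JL : real_linear J.
Hypothesis JC : forall x y, ip (J x) y = ip x (J y).
Hypothesis Jiso : forall x, ip (J x) (J x) = ip x x.

(** Continuity of both quadratic forms, written out for g = f - z with z small. *)
Lemma closure_form_ge M f al : 0 <= al -> closure M f ->
  (forall g, M g -> al * ip g g <= ip (J g) g) -> al * ip f f <= ip (J f) f.
Proof.
move=> al0 /(closure_dist ipP) Mf h.
(* 2 w is the gradient at [f] of <J f, f> - al |f|^2, so the first-order change is 2 <w, z>. *)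
have [w wE] : exists w, w = J f - al%:C *: f by exists (J f - al%:C *: f).
(* The first-order term costs at most d (|w|^2 + 1), the second-order one at most |z|^2 < d^2 <=
   d. *)
rewrite -subr_le0; apply: (@le0_eps _ _ (ip w w + 2)).
  by rewrite addr_ge0// (ip_ge0 ipP).
move=> e e0; pose d := Num.min 1 e.
have d0 : 0 < d by rewrite lt_min ltr01.
have [d1 de] : d <= 1 /\ d <= e by rewrite !ge_min !lexx orbT.
have [g Mg fg] := Mf _ (exprn_gt0 2 d0).
have {h} := h g Mg.
have [z gE] : exists z, g = f - z by exists (f - g); rewrite opprB addrC subrK.
have {}fg : ip z z < d ^+ 2 by move: fg; rewrite gE opprB addrC subrK.
rewrite {g Mg}gE.
rewrite (ip_sqB ipP f) (real_linearB _ _ JL) (ipBl ipP (J f)) !(ipBr ipP).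
have -> : ip (J z) f = ip (J f) z by rewrite JC (ipC ipP).
have w0 := ip_ge0 ipP w; have z0 := ip_ge0 ipP z.
have := ip_ge0 ipP (d%:C *: w + z); rewrite (ip_sqD ipP _ z) !(ipZl ipP) (ipZr ipP).
have -> : ip w z = ip (J f) z - al * ip f z by rewrite wE (ipBl ipP) (ipZl ipP).
have := ip_ge0 ipP (J z - z); rewrite (ip_sqB ipP _ z) Jiso.
have zd : ip z z <= d by rewrite (le_trans (ltW fg))// expr2 ger_pMl.
move: fg; set p := ip (J f) z - al * ip f z => fg hz hd hg.
have : - (2 * p) <= d * (ip w w + 1) by rewrite -(ler_pM2l d0); nra.
have : d * (ip w w + 2) <= e * (ip w w + 2) by rewrite ler_wpM2r// addr_ge0.
have : 0 <= al * ip z z by rewrite mulr_ge0.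
rewrite /p; lra.
Qed.

Context {I : choiceType}.
Variables (v : I -> R) (P : I -> K -> K) (B a : R) (M : set K).
Hypothesis PP : forall i, orthogonal_projection ip (P i).
Hypothesis B0 : 0 < B.
Hypothesis bessel : forall f F, frame_partial ip v P f F <= B * ip f f.
Hypothesis Msub : real_subspace M.
Hypothesis Mcl : closed M.
Hypothesis MP : forall i x, M (P i x).
Hypothesis Mnondeg :
  forall x, M x -> (forall y, M y -> ip (J x) y = 0) -> x = 0.
Hypothesis a0 : 0 < a.
Hypothesis Mpos : forall x, M x -> 0 <= ip (J x) x.
Hypothesis lower : forall x t, M x ->
  (forall F, frame_partial ip v P (J x) F <= t) -> a * ip (J x) x <= t.

(** Spectral calculus is replaced by a bound on the range of G, extended to its closure, which is
    [M] since G is self-adjoint and injective there. Then G is coercive, hence onto, and each f = G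
    x inherits a lower frame bound. *)
Lemma signed_frame_positive_onto :
  (exists2 al : R, 0 < al & forall f, M f -> al * ip f f <= ip (J f) f) /\
  forall f, M f -> exists g C, coefficients ip P g C /\ synthesis v g = f.
Proof.
have [M0 MD MZ] := Msub.
have [Q [MQ Qort]] := projection_function Msub Mcl.
have QP := best_approximation_projection Msub MQ Qort.
have [[QD QZ] QC] := QP.
pose G x := Q (J x).
have GL : real_linear G.
  by split=> [x y|c x]; rewrite /G; [rewrite (proj1 JL) QD|rewrite (proj2 JL) QZ].
have GE x y : M y -> ip (G x) y = ip (J x) y.
  move=> My; apply/eqP; rewrite eq_sym -subr_eq0 -(ipBl ipP); apply/eqP.
  exact: Qort.
have Gle x : ip (G x) (G x) <= ip x x.
  rewrite -(Jiso x); have := ip_ge0 ipP (J x - G x).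
  by rewrite (ip_sqB ipP) -(GE x _ (MQ (J x))) -/(G x); lra.
(* [P i] maps into [M], so it kills the part of [J x] orthogonal to [M]. *)
have PG i x : P i (J x) = P i (G x).
  apply/eqP; rewrite -subr_eq0 -(real_linearB _ _ (proj1 (PP i))).
  apply/eqP/(ip_eq0 ipP).
  by rewrite (projectionC ipP _ _ (PP i)) Qort.
have partialG x F : frame_partial ip v P (J x) F = frame_partial ip v P (G x) F.
  by apply: eq_bigr => i _; rewrite PG.
have upG x : M x -> a * ip (J x) x <= B * ip (G x) (G x).
  by move=> Mx; apply: lower => // F; rewrite partialG.
(* On the range of [G]: if [g = G h] then [|g|^4 = [h, g]^2 <= [h, h] [g, g]] by
   the Cauchy-Schwarz inequality of [J], and [[h, h] <= (B / a) |g|^2]. *)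
have rangeG h : M h -> a / B * ip (G h) (G h) <= ip (J (G h)) (G h).
  move=> Mh; have Mg : M (G h) by exact: MQ.
  have := @cauchy_schwarz R K (fun x y => ip (J x) y) M h (G h) Msub.
  have := upG _ Mh; have := Mpos Mg; have := Mpos Mh.
  rewrite -(GE h (G h))//; have := ip_ge0 ipP (G h).
  set X := ip (G h) (G h); set s := ip (J h) h; set u := ip (J (G h)) (G h).
  rewrite le_eqVlt => /predU1P[<-|X0] s0 u0 sX cs.
    by rewrite mulr0.
  have {cs} : X ^+ 2 <= s * u.
    apply: cs => //.
    - by move=> x y; rewrite JC (ipC ipP).
    - by move=> x y z; rewrite (proj1 JL) (ipDl ipP).
    - by move=> c x y; rewrite (proj2 JL) (ipZl ipP).
  move=> Xsu; rewrite mulrAC ler_pdivrMr// -(ler_pM2l X0).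
  have := ler_wpM2l (ltW a0) Xsu; have := ler_wpM2r u0 sX; nra.
have denseG f : M f -> closure [set G h | h in M] f.
  move=> Mf; pose N := [set G h | h in M].
  have Nsub : real_subspace N.
    split; first by exists 0 => //; rewrite (real_linear0 GL).
      by move=> _ _ [x Mx <-] [y My <-]; exists (x + y);
        [exact: MD|exact: (proj1 GL)].
    by move=> c _ [x Mx <-]; exists (c%:C *: x); [exact: MZ|exact: (proj2 GL)].
  have NM : closure N `<=` M.
    rewrite (proj1 (closure_id M) Mcl); apply: closureS => _ [x _ <-].
    exact: MQ.
  (* The remainder [f - p] is orthogonal to every [G y], so the form pairs it to 0 with all of
     [M]. *)
  have [p [Np fp]] := projection_exists ipP f
    (closure_real_subspace ipP Nsub) (@closed_closure _ N).
  have Mfp : M (f - p) by apply: real_subspaceB => //; exact: NM.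
  suff -> : f = p by [].
  apply/eqP; rewrite -subr_eq0; apply/eqP/Mnondeg => // y My.
  by rewrite JC (ipC ipP) -GE// (ipC ipP) fp//; apply: subset_closure; exists y.
have upos : forall f, M f -> a / B * ip f f <= ip (J f) f.
  move=> f /denseG Gf; apply: closure_form_ge Gf _; first by rewrite ltW ?divr_gt0.
  by move=> _ [h Mh <-]; apply: rangeG.
have aB0 : 0 < a / B by rewrite divr_gt0.
split; first by exists (a / B).
(* For f = G x, a <J x, x> <= t while <J x, x> >= (a / B) |x|^2 >= (a / B) |f|^2. *)
apply: (@frame_synthesis_onto _ _ ip ipP _ v P B PP B0 bessel M (a * (a / B))) => //.
  by rewrite mulr_gt0.
move=> f t Mf hf.
have [||x Mx xf] := coercive_onto ipP Msub Mcl GL (fun x _ => MQ (J x)) aB0 ler01 _ _ Mf.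
- by move=> x _; rewrite mul1r.
- by move=> x Mx; rewrite GE//; apply: upos.
apply: le_trans (_ : a * ip (J x) x <= t); last first.
  by apply: lower => // F; rewrite partialG xf.
rewrite -mulrA ler_pM2l//; apply: le_trans (upos _ Mx).
by rewrite ler_pM2l// -xf.
Qed.

End GramOperator.

(** * Krein spaces: the fundamental symmetry and its real inner product *)

Section KreinSpace.
Context {R : realType} {K : completeNormedModType R[i]}.
Variable form : indefinite_form K.
Variable J : K -> K.
Hypothesis krein : krein_space form J.

Lemma form_sym x y : form x y = conjc (form y x).
Proof. by rewrite hermitian_subproof expr0 mul1r. Qed.

Lemma formZr a x y : form x (a *: y) = conjc a * form x y.
Proof. by rewrite linearZr_LR. Qed.

Lemma formZl a x y : form (a *: x) y = a * form x y.
Proof. by rewrite linearZl_LR. Qed.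

Lemma ReD (x y : R[i]) : complex.Re (x + y) = complex.Re x + complex.Re y.
Proof. by case: x; case: y. Qed.

Lemma ReB (x y : R[i]) : complex.Re (x - y) = complex.Re x - complex.Re y.
Proof. by case: x; case: y. Qed.

Lemma ReZ a (x : R[i]) : complex.Re (a%:C * x) = a * complex.Re x.
Proof. by case: x => b c /=; rewrite mul0r subr0. Qed.

Lemma Re_conjc (x : R[i]) : complex.Re (conjc x) = complex.Re x.
Proof. by case: x. Qed.

Lemma Re_ge0 (x : R[i]) : 0 <= x -> 0 <= complex.Re x.
Proof. by rewrite lecE => /andP[]. Qed.

Lemma Re_le0 (x : R[i]) : x <= 0 -> complex.Re x <= 0.
Proof. by rewrite lecE => /andP[]. Qed.

Lemma subspace_in (W : set K) : Defs.subspace W ->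
  [/\ W 0, (forall x y, W x -> W y -> W (x + y)) &
      (forall a x, W x -> W (a *: x))].
Proof.
move=> [/= W0 WL]; move: W0; rewrite inE => W0; split => // [x y Wx Wy|a x Wx].
  by have := WL 1 x y; rewrite !inE scale1r; apply.
by have := WL a x 0; rewrite !inE addr0; apply.
Qed.

Lemma in_subspace (W : set K) :
  W 0 -> (forall x y, W x -> W y -> W (x + y)) ->
  (forall a x, W x -> W (a *: x)) -> Defs.subspace W.
Proof.
move=> W0 WD WZ; split=> [|a x y] /=; first by rewrite inE.
by rewrite !inE => Wx Wy; apply: WD => //; apply: WZ.
Qed.

Lemma subspace_real (W : set K) : Defs.subspace W -> real_subspace W.
Proof. by move=> /subspace_in[W0 WD WZ]; split=> // a x; apply: WZ. Qed.

Lemma symmetry_decomposition :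
  exists Kp Km : set K, [/\ Defs.subspace Kp, Defs.subspace Km,
    (forall h, exists f g, [/\ Kp f, Km g & h = f + g]),
    (forall f g, Kp f -> Km g ->
       [/\ J (f + g) = f - g, form f g = 0 & form g f = 0]) &
    (forall f, Kp f -> 0 <= form f f) /\ (forall g, Km g -> form g g <= 0)].
Proof.
have [[Kp [Km [[[Kps Kms] dec ort pos neg] JE]]] _] := krein.
exists Kp, Km; split => //.
- move=> f g Kf Kg; split; [exact: JE|exact: ort|].
  by rewrite form_sym ort// conjc0.
- split=> f Kf.
    have [->|f0] := eqVneq f 0; first by rewrite linear0l.
    exact/ltW/pos.
  have [->|f0] := eqVneq f 0; first by rewrite linear0l.
  exact/ltW/neg.
Qed.

Lemma symmetry_linear : real_linear J.
Proof.
have [Kp [Km [/subspace_in[_ pD pZ] /subspace_in[_ mD mZ] dec JE _]]] :=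
  symmetry_decomposition.
split=> [x y|a x].
  have [f [g [Kf Kg ->]]] := dec x; have [f' [g' [Kf' Kg' ->]]] := dec y.
  rewrite addrACA; have [->] := JE _ _ (pD _ _ Kf Kf') (mD _ _ Kg Kg').
  have [->] := JE _ _ Kf Kg; have [->] := JE _ _ Kf' Kg'.
  by rewrite opprD addrACA.
have [f [g [Kf Kg ->]]] := dec x.
rewrite scalerDr; have [->] := JE _ _ (pZ a%:C _ Kf) (mZ a%:C _ Kg).
by have [->] := JE _ _ Kf Kg; rewrite scalerBr.
Qed.

Lemma symmetryK x : J (J x) = x.
Proof.
have [Kp [Km [_ /subspace_in[_ _ mZ] dec JE _]]] := symmetry_decomposition.
have [f [g [Kf Kg ->]]] := dec x; have [-> _ _] := JE _ _ Kf Kg.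
have KNg : Km (- g) by rewrite -scaleN1r; apply: mZ.
by have [-> _ _] := JE _ _ Kf KNg; rewrite opprK.
Qed.

Lemma symmetry_selfadjoint x y : form (J x) y = form x (J y).
Proof.
have [Kp [Km [_ _ dec JE _]]] := symmetry_decomposition.
have [f [g [Kf Kg ->]]] := dec x; have [f' [g' [Kf' Kg' ->]]] := dec y.
have [-> _ _] := JE _ _ Kf Kg; have [-> _ _] := JE _ _ Kf' Kg'.
rewrite linearBl linearDl !linearDr !linearNr /=.
have [_ -> _] := JE _ _ Kf Kg'; have [_ _ ->] := JE _ _ Kf' Kg.
by rewrite !(addr0, add0r, oppr0).
Qed.

Definition re_ip (x y : K) : R := complex.Re (ipJ form J x y).

Lemma re_ipP : real_inner_product re_ip.
Proof.
split.
- by move=> x y; rewrite /re_ip /ipJ form_sym Re_conjc symmetry_selfadjoint.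
- by move=> x y z; rewrite /re_ip /ipJ (proj1 symmetry_linear) linearDl ReD.
- by move=> a x y; rewrite /re_ip /ipJ (proj2 symmetry_linear) linearZl_LR ReZ.
- move=> x; have [Kp [Km [_ _ dec JE [pos neg]]]] := symmetry_decomposition.
  have [f [g [Kf Kg ->]]] := dec x; rewrite /re_ip /ipJ.
  have [-> fg gf] := JE _ _ Kf Kg.
  rewrite linearBl !linearDr /= fg gf addr0 add0r ReB subr_ge0.
  by apply: le_trans (Re_le0 (neg _ Kg)) (Re_ge0 (pos _ Kf)).
- by case: krein.
Qed.

Lemma normJ_sqr x : normJ form J x ^+ 2 = re_ip x x.
Proof. exact: sqr_sqrtr (ip_ge0 re_ipP x). Qed.

Lemma re_ip_symmetry x y : re_ip (J x) y = complex.Re (form x y).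
Proof. by rewrite /re_ip /ipJ symmetryK. Qed.

Lemma sqE x : sq form x = re_ip (J x) x.
Proof. by rewrite re_ip_symmetry. Qed.

Lemma re_ip_selfadjoint x y : re_ip (J x) y = re_ip x (J y).
Proof. by rewrite /re_ip /ipJ symmetry_selfadjoint. Qed.

Lemma re_ip_isometry x : re_ip (J x) (J x) = re_ip x x.
Proof. by rewrite -re_ip_selfadjoint symmetryK. Qed.

(** Replacing y by i y turns the real part of [x, y] into its imaginary part. *)
Lemma Re_form_eq0 (W : set K) x : Defs.subspace W ->
  (forall y, W y -> complex.Re (form x y) = 0) -> forall y, W y -> form x y = 0.
Proof.
move=> /subspace_in[_ _ WZ] h y Wy; apply/eqP.
rewrite eq_complex h//= eqxx /=; apply/eqP.
have := h _ (WZ 'i%C _ Wy); rewrite formZr.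
by case: (form x y) => a b /=; rewrite mul0r sub0r mulN1r opprK.
Qed.

(** The real projection exists, and its orthogonality is complex because [W] is a complex subspace;
    the default value of [xget] is thus excluded. *)
Lemma piWP (W : set K) f : Defs.subspace W -> closed W ->
  W (piW form J W f) /\ forall g, W g -> ipJ form J (f - piW form J W f) g = 0.
Proof.
move=> Ws Wc; have [p [Wp hp]] :=
  projection_exists re_ipP f (subspace_real Ws) Wc.
rewrite /piW; case: xgetP => [q -> []//|/(_ p)[]].
by split => //; apply: (Re_form_eq0 Ws).
Qed.

Lemma piW_projection (W : set K) : Defs.subspace W -> closed W ->
  orthogonal_projection re_ip (piW form J W).
Proof.
move=> Ws Wc; apply: (best_approximation_projection re_ipP (subspace_real Ws)).
  by move=> x; case: (piWP x Ws Wc).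
by move=> x y Wy; rewrite /re_ip (proj2 (piWP x Ws Wc)).
Qed.

Lemma piW_id (W : set K) x : Defs.subspace W -> closed W -> W x -> piW form J W x = x.
Proof.
move=> Ws Wc Wx; have [Wp hp] := piWP x Ws Wc.
apply/esym/eqP; rewrite -subr_eq0; apply/eqP/(ip_eq0 re_ipP).
by rewrite /re_ip hp//; apply: (real_subspaceB (subspace_real Ws)).
Qed.

Lemma norm_form_piW (W : set K) f : Defs.subspace W -> closed W ->
  complex.Re `|form (piW form J W (J f)) f|
  = re_ip (piW form J W (J f)) (piW form J W (J f)).
Proof.
move=> Ws Wc; have [Wp hp] := piWP (J f) Ws Wc; set p := piW _ _ _ _ in Wp hp *.
have -> : form p f = ipJ form J p p.
  have : ipJ form J (J f) p = ipJ form J p p.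
    apply/eqP; rewrite -subr_eq0 -(hp p Wp) /ipJ -linearBl.
    by rewrite -(real_linearB _ _ symmetry_linear).
  rewrite {1}/ipJ symmetryK => fp; rewrite form_sym fp.
  by rewrite /ipJ -form_sym symmetry_selfadjoint.
have pE : ipJ form J p p = (re_ip p p)%:C.
  have : ipJ form J p p = conjc (ipJ form J p p).
    by rewrite {1}/ipJ symmetry_selfadjoint form_sym.
  rewrite /re_ip; case: (ipJ form J p p) => a b [] /eqP.
  by rewrite -subr_eq0 opprK -mulr2n mulrn_eq0 => /eqP ->.
by rewrite pE ger0_norm ?lecR ?(ip_ge0 re_ipP).
Qed.

End KreinSpace.

(** * Bounds on extended sums through finite sums *)

Lemma esum_le_fin (R : realType) (I : choiceType) (D : set I) (a : I -> R) t :
  (\esum_(i in D) (a i)%:E <= t%:E)%E <->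
  forall F : {fset I}, \sum_(i <- F) (if i \in D then a i else 0) <= t.
Proof.
have aE i : (if i \in D then (a i)%:E else 0%E) =
    (if i \in D then a i else 0)%:E by case: ifP.
rewrite esum_mkcond; under eq_esum do rewrite aE.
split=> [h F|h].
  rewrite -lee_fin -sumEFin; apply: le_trans h; apply: ereal_sup_ubound.
  exists [set` F]; first by split.
  by rewrite fsbig_finite//= set_fsetK.
apply: ge_ereal_sup => _ [A [Afin _] <-].
by rewrite fsbig_finite//= sumEFin lee_fin.
Qed.

(** * Closed sums of subspaces, and subfamilies as families of projections *)

Section KreinFamilies.
Context {R : realType} {K : completeNormedModType R[i]}.
Variable form : indefinite_form K.
Variable J : K -> K.
Hypothesis krein : krein_space form J.
Context {I : choiceType}.
Variables (W : I -> set K) (v : I -> R).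
Hypothesis weighted : weighted_subspaces W v.

Let ip := re_ip form J.
Let ipP : real_inner_product ip := re_ipP krein.

Lemma big_fset_restrict (V : nmodType) (F G : {fset I}) (h : I -> V) :
  (F `<=` G)%fset ->
  \sum_(i <- G) (if i \in F then h i else 0) = \sum_(i <- F) h i.
Proof.
move=> FG; rewrite (big_fsetU_sub _ FG) [X in _ + X]big1_seq ?addr0.
  by rewrite [LHS]big_seq [RHS]big_seq; apply: eq_bigr => i ->.
by move=> i /=; rewrite in_fsetD => /andP[/negbTE ->].
Qed.

Lemma sum_subspaces_subspace D : Defs.subspace (sum_subspaces W D).
Proof.
have Ws i := subspace_in (let: And3 Wi _ _ := weighted i in Wi).
apply: in_subspace.
- by exists fset0, (fun=> 0); split => //; rewrite big_seq_fset0.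
- move=> _ _ [F [f [fF ->]]] [G [g [gG ->]]].
  (* Both families are extended by 0 to the union of their index sets. *)
  exists (F `|` G)%fset,
    (fun i => (if i \in F then f i else 0) + (if i \in G then g i else 0)).
  split; last first.
    by rewrite big_split /= !big_fset_restrict ?fsubsetUl ?fsubsetUr.
  move=> i; rewrite in_fsetU => iFG; have [W0 WD _] := Ws i.
  split; first by case/orP: iFG => [/fF[]|/gG[]].
  by apply: WD; [case: ifP => [/fF[]|]|case: ifP => [/gG[]|]].
- move=> a _ [F [f [fF ->]]]; exists F, (fun i => a *: f i); split.
    by move=> i /fF[Di Wi]; split => //; have [_ _] := Ws i; apply.
  by rewrite scaler_sumr.
Qed.

(** Real scalars are covered by the real case; multiplication by i is an isometry, so it preserves
    the closure, and a = Re a + i Im a. *)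
Lemma closure_subspace (M : set K) : Defs.subspace M -> Defs.subspace (closure M).
Proof.
move=> Ms; have [M0 MD MZ] := closure_real_subspace ipP (subspace_real Ms).
have Mi x : closure M x -> closure M ('i%C *: x).
  move=> /(closure_dist ipP) h; apply/(closure_dist ipP) => e /h[y My xy].
  exists ('i%C *: y); first by have [_ _] := subspace_in Ms; apply.
  move: xy; rewrite -scalerBr; set z := x - y.
  suff -> : ip ('i%C *: z) ('i%C *: z) = ip z z by [].
  rewrite /ip /re_ip /ipJ formZr (symmetry_selfadjoint krein) formZl mulrA.
  have -> : conjc 'i%C * 'i%C = 1 :> R[i].
    have -> : conjc 'i%C = - 'i%C :> R[i] by rewrite /= -[RHS]/(_ +i* _) oppr0.
    by rewrite mulNr -expr2 sqr_i opprK.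
  by rewrite mul1r -(symmetry_selfadjoint krein).
apply: in_subspace => // a x Mx.
rewrite (complexE a) scalerDl mulrC -scalerA.
by apply: MD; [apply: MZ|apply: MZ; apply: Mi].
Qed.

Lemma closed_sum_subspace D : Defs.subspace (closed_sum W D).
Proof. exact/closure_subspace/sum_subspaces_subspace. Qed.

Lemma closed_sum_ge D i : D i -> W i `<=` closed_sum W D.
Proof.
move=> Di x Wx; apply: subset_closure; exists [fset i]%fset, (fun=> x).
by split=> [j|]; rewrite ?big_seq_fset1// inE => /eqP ->.
Qed.

(** Zero projections off [D] keep the index type, so the results on synthesis apply to each
    subfamily. *)
Definition piD (D : set I) (i : I) (x : K) : K :=
  if i \in D then piW form J (W i) x else 0.

Lemma piD_projection D i : orthogonal_projection ip (piD D i).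
Proof.
rewrite /piD; case: (i \in D).
  by have [Ws Wc _] := weighted i; apply: piW_projection.
by split; [split=> *; rewrite ?addr0 ?scaler0|move=> *; rewrite !(ip0l ipP)].
Qed.

Lemma piD_closed_sum D i x : closed_sum W D (piD D i x).
Proof.
rewrite /piD; case: ifPn => [|_].
  rewrite inE => Di; apply: (closed_sum_ge Di).
  by have [Ws Wc _] := weighted i; case: (piWP krein x Ws Wc).
by have [] := subspace_in (closed_sum_subspace D).
Qed.

Lemma frame_partialE D x F : frame_partial ip v (piD D) x F =
  \sum_(i <- F) (if i \in D then
    v i ^+ 2 * ip (piW form J (W i) x) (piW form J (W i) x) else 0).
Proof.
apply: eq_bigr => i _; rewrite /piD; case: ifP => // _.
by rewrite (ip0l ipP) mulr0.
Qed.

Lemma frame_sum_le x t : (frame_sum form J W v x <= t%:E)%E <->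
  forall F, frame_partial ip v (piD setT) x F <= t.
Proof.
rewrite /frame_sum; under eq_esum do rewrite (normJ_sqr krein).
by split=> [/esum_le_fin|] h; [|apply/esum_le_fin]; move=> F;
  have := h F; rewrite frame_partialE.
Qed.

Lemma signed_frame_sum_le D x t : (signed_frame_sum form J W v D x <= t%:E)%E <->
  forall F, frame_partial ip v (piD D) (J x) F <= t.
Proof.
rewrite /signed_frame_sum.
have E i : D i -> (v i ^+ 2 * complex.Re `|form (piW form J (W i) (J x)) x|)%:E =
    (v i ^+ 2 * ip (piW form J (W i) (J x)) (piW form J (W i) (J x)))%:E.
  by move=> _; have [Ws Wc _] := weighted i; rewrite norm_form_piW.
rewrite (eq_esum E).
by split=> [/esum_le_fin|] h; [|apply/esum_le_fin]; move=> F;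
  have := h F; rewrite frame_partialE.
Qed.

Lemma frame_partial_piD_le D x F :
  frame_partial ip v (piD D) x F <= frame_partial ip v (piD setT) x F.
Proof.
rewrite !frame_partialE; apply: ler_sum => i _; rewrite in_setT.
by case: ifP => // _; rewrite mulr_ge0 ?sqr_ge0 ?(ip_ge0 ipP).
Qed.

Lemma coefficients_proj D E g C : coefficients ip (piD E) g C ->
  coefficients ip (piD E) (proj_l2 D g) C.
Proof.
move=> [gP gC]; split=> [i|F].
  rewrite /proj_l2 /patch; case: ifP => // _.
  exact: (real_linear0 (proj1 (piD_projection E i))).
apply: le_trans (gC F); apply: ler_sum => i _; rewrite /proj_l2 /patch.
by case: ifP => // _; rewrite (ip0l ipP) (ip_ge0 ipP).
Qed.

Lemma coefficients_restrict D g C : coefficients ip (piD setT) g C ->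
  coefficients ip (piD D) (proj_l2 D g) C.
Proof.
move=> /(coefficients_proj D)[gP gC]; split=> // i.
have := gP i; rewrite /piD in_setT /proj_l2 /patch.
by case: ifP.
Qed.

Lemma l2_sum_coefficients g : l2_sum form J W g ->
  exists C, coefficients ip (piD setT) g C.
Proof.
move=> [Wg]; under eq_esum do rewrite (normJ_sqr krein).
rewrite -/ip; case E : (\esum_(i in _) _)%E => [C| |] // _; last first.
  have : (0 <= \esum_(i in [set: I]) (ip (g i) (g i))%:E)%E.
    by apply: esum_ge0 => i _; rewrite lee_fin (ip_ge0 ipP).
  by rewrite E.
exists C; split=> [i|F].
  by rewrite /piD in_setT; have [Ws Wc _] := weighted i; apply: piW_id.
have /esum_le_fin/(_ F) : (\esum_(i in [set: I]) (ip (g i) (g i))%:E <= C%:E)%E.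
  by rewrite E.
by under eq_bigr do rewrite in_setT.
Qed.

Lemma coefficients_l2_sum D g C : coefficients ip (piD D) g C ->
  l2_sum form J W g /\ proj_l2 D g = g.
Proof.
move=> [gP gC]; split; first split.
- move=> i; rewrite -(gP i) /piD; have [Ws Wc _] := weighted i.
  case: ifP => _; first by case: (piWP krein (g i) Ws Wc).
  by case: (subspace_in Ws).
- under eq_esum do rewrite (normJ_sqr krein).
  apply: (@le_lt_trans _ _ C%:E); last exact: ltry.
  by apply/esum_le_fin => F; under eq_bigr do rewrite in_setT; exact: gC.
- apply/funext => i; rewrite /proj_l2 /patch; case: ifPn => // iD.
  by rewrite -(gP i) /piD (negbTE iD).
Qed.

End KreinFamilies.

(** * Uniform definiteness, spanning and maximality of the closed sums *)

Section JFusionFrame.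
Context {R : realType} {K : completeNormedModType R[i]}.
Variable form : indefinite_form K.
Variable J : K -> K.
Hypothesis krein : krein_space form J.
Context {I : choiceType}.
Variables (W : I -> set K) (v : I -> R).
Hypothesis weighted : weighted_subspaces W v.

Let ip := re_ip form J.
Let ipP : real_inner_product ip := re_ipP krein.

Section Bessel.
Variable B : R.
Hypothesis B0 : 0 < B.
Hypothesis frame_le : forall f, (frame_sum form J W v f <= (B * ip f f)%:E)%E.

Lemma piD_bessel D f F :
  frame_partial ip v (piD form J W D) f F <= B * ip f f.
Proof.
apply: le_trans (frame_partial_piD_le krein W v D f F) _.
exact: (proj1 (frame_sum_le krein W v f (B * ip f f)) (frame_le f)).
Qed.

Lemma synthesis_range_sub D : synthesis_range form J W v D `<=` closed_sum W D.
Proof.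
move=> _ [g gl2 <-].
have [C /(coefficients_restrict krein weighted D)gC] := l2_sum_coefficients krein weighted gl2.
apply: (synthesis_closed ipP (piD_projection krein weighted D) B0
  (piD_bessel D) gC).
- exact/subspace_real/(closed_sum_subspace krein weighted).
- exact: closed_closure.
- by move=> i; rewrite -(proj1 gC i); apply: piD_closed_sum.
Qed.

(* With [s = -1], that is with [- J] in place of [J], the same argument covers
   the negative family. *)
Lemma definite_family (s : R) D A :
  let M := closed_sum W D in
  s ^+ 2 = 1 -> 0 < A ->
  M `&` orthJ_compl form M = [set 0] ->
  (forall f, M f -> 0 <= s * sq form f) ->
  (forall f, M f ->
    ((A * (s * sq form f))%:E <= signed_frame_sum form J W v D f)%E) ->
  (exists2 al : R, 0 < al &
     forall f, M f -> al * ip f f <= s * sq form f) /\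
  synthesis_range form J W v D = M.
Proof.
move=> M s2 A0 Mnondeg Mpos Mlow.
pose J' x := s%:C *: J x.
have [JD JZ] := symmetry_linear krein.
have J'L : real_linear J'.
  split=> [x y|a x]; first by rewrite /J' JD scalerDr.
  by rewrite /J' JZ !scalerA mulrC.
have J'sq x : ip (J' x) x = s * sq form x.
  by rewrite (ipZl ipP) (sqE krein).
have Msub := closed_sum_subspace krein weighted D.
have J'partial x F : frame_partial ip v (piD form J W D) (J' x) F =
    frame_partial ip v (piD form J W D) (J x) F.
  apply: eq_bigr => i _.
  rewrite (proj2 (proj1 (piD_projection krein weighted D i))).
  by rewrite (ipZl ipP) (ipZr ipP) [s * (s * _)]mulrA -expr2 s2 mul1r.
have [||||||al_ex onto] := @signed_frame_positive_onto _ _ ip ipP J' J'L _ _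
  I v (piD form J W D) B A M (piD_projection krein weighted D) B0 (piD_bessel D)
  (subspace_real Msub) (@closed_closure _ _) _ _ A0 _ _.
- move=> x y; rewrite (ipZl ipP) (ipZr ipP); congr (_ * _).
  exact: (re_ip_selfadjoint krein).
- move=> x; rewrite (ipZl ipP) (ipZr ipP) mulrA -expr2 s2 mul1r.
  exact: (re_ip_isometry krein).
- exact: piD_closed_sum.
(* [Mnondeg] concerns the complex form, [h] the real one twisted by [s]; the factor is removed by
   s^2 = 1. *)
- move=> x Mx h; suff : (M `&` orthJ_compl form M) x by rewrite Mnondeg.
  split=> //; apply: (Re_form_eq0 Msub) => y My.
  apply/eqP; rewrite -(re_ip_symmetry krein) -[re_ip _ _ _ _]mul1r -s2 expr2 -mulrA.
  by rewrite -(ipZl ipP) h// mulr0.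
- by move=> x Mx; rewrite J'sq; apply: Mpos.
- move=> x t Mx h; rewrite J'sq -lee_fin; apply: le_trans (Mlow x Mx) _.
  apply/(signed_frame_sum_le krein weighted) => F; rewrite -J'partial; exact: h.
- split.
    by have [al al0 h] := al_ex; exists al => // f Mf; rewrite -J'sq; apply: h.
  apply/seteqP; split; first exact: synthesis_range_sub.
  move=> f /onto[g [C [gC <-]]].
  have [gl2 gD] := coefficients_l2_sum krein weighted gC.
  by exists g => //; rewrite gD.
Qed.

(** The lower frame bound makes synthesis onto the whole space; the coefficients of [f] are then
    split along [Iplus] and its complement. *)
Lemma closed_sums_span A : 0 < A ->
  (forall f, ((A * ip f f)%:E <= frame_sum form J W v f)%E) ->
  (forall i, J_nonnegative form (W i) \/ J_negative form (W i)) ->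
  forall f, exists g h, [/\ closed_sum W (Iplus form W) g,
    closed_sum W (Iminus form W) h & f = g + h].
Proof.
move=> A0 frame_ge sgn f.
have PP := piD_projection krein weighted setT.
have [|||||g [C [gC gf]]] := @frame_synthesis_onto _ _ ip ipP _ v
  (piD form J W setT) B PP B0 (piD_bessel setT) setT A _ _ _ A0 _ f.
- by [].
- exact: closedT.
- by [].
- move=> x t _ h; rewrite -lee_fin; apply: le_trans (frame_ge x) _.
  by apply/(frame_sum_le krein).
- by [].
have part D : coefficients ip (piD form J W setT) (proj_l2 D g) C.
  exact: (coefficients_proj krein weighted D gC).
have Wg i : W i (g i) by case: (coefficients_l2_sum krein weighted gC) => -[].
have in_sum D E : (forall i, D i -> E i) ->
    closed_sum W E (synthesis v (proj_l2 D g)).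
  move=> DE; apply: (synthesis_closed ipP PP B0 (piD_bessel setT) (part D)).
  - exact/subspace_real/(closed_sum_subspace krein weighted).
  - exact: closed_closure.
  - move=> i; rewrite /proj_l2 /patch; case: ifPn => [|_].
      by rewrite inE => /DE Ei; apply: closed_sum_ge Ei _ (Wg i).
    by have [] := subspace_in (closed_sum_subspace krein weighted E).
exists (synthesis v (proj_l2 (Iplus form W) g)).
(* The complement of [Iplus] lies in [Iminus]: such a subspace is J-negative by [sgn], and it is not
   {0}, which is J-nonnegative. *)
exists (synthesis v (proj_l2 (~` Iplus form W) g)).
split; [exact: in_sum|apply: in_sum => i Ii|].
  split=> [Wi0|]; last by case: (sgn i).
  by apply: Ii => x; rewrite Wi0 => ->; rewrite /sq linear0l.
rewrite -(synthesisD ipP PP B0 (piD_bessel setT) (part _) (part _)) -gf.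
congr synthesis; apply/funext => i; rewrite /proj_l2 /patch in_setC.
by case: (i \in _); rewrite ?addr0 ?add0r.
Qed.

End Bessel.

(** If [W'] contains [M] and f = g + h is in [W'], then h = f - g is in both [W'] and [N], so ga
    |h|^2 <= s [h, h] <= - be |h|^2 and h = 0. *)
Lemma maximal_definite (s be : R) (M N : set K) (P : set K -> Prop) :
  Defs.subspace M -> P M ->
  (forall W', P W' -> exists2 ga : R, 0 < ga &
     forall f, W' f -> ga * normJ form J f ^+ 2 <= s * sq form f) ->
  0 < be -> (forall f, N f -> be * ip f f <= - (s * sq form f)) ->
  (forall f, exists g h, [/\ M g, N h & f = g + h]) ->
  maximal_subspace P M.
Proof.
move=> Ms PM Ppos be0 Nneg span; split=> // W' W's PW' MW'.
apply/seteqP; split=> // f W'f.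
have [g [h [Mg Nh fE]]] := span f.
have W'h : W' h.
  have -> : h = f - g by rewrite fE addrC addKr.
  by apply: (real_subspaceB (subspace_real W's)) => //; exact: MW'.
have [ga ga0 /(_ _ W'h)] := Ppos _ PW'; rewrite (normJ_sqr krein) => h1.
have h2 := Nneg _ Nh.
suff h0 : h = 0 by rewrite fE h0 addr0.
apply: (ip_eq0 ipP); rewrite -(pmulr_rle0 _ (addr_gt0 ga0 be0)).
by rewrite mulrDl; rewrite -/ip in h1; lra.
Qed.

End JFusionFrame.

(** * Both signs combined *)

Theorem theorem2p4 (R : realType) (K : completeNormedModType R[i])
    (form : indefinite_form K) (J : K -> K)
    (I : choiceType) (W : I -> set K) (v : I -> R) (Ap Bp Am Bm : R) :
  krein_space form J ->
  fusion_frame form J W v ->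
  (forall i, J_nonnegative form (W i) \/ J_negative form (W i)) ->
  let Ip := Iplus form W in
  let Im := Iminus form W in
  let Mp := closed_sum W Ip in
  let Mm := closed_sum W Im in
  Mp `&` orthJ_compl form Mp = [set 0] ->
  Mm `&` orthJ_compl form Mm = [set 0] ->
  Bm <= Am -> Am < 0 -> 0 < Ap -> Ap <= Bp ->
  (forall f, Mp f ->
    ((Ap * sq form f)%:E <= signed_frame_sum form J W v Ip f
                         <= (Bp * sq form f)%:E)%E) ->
  (forall f, Mm f ->
    ((Am * sq form f)%:E <= signed_frame_sum form J W v Im f
                         <= (Bm * sq form f)%:E)%E) ->
  J_fusion_frame form J W v.
Proof.
move=> krein ff sgn Ip Im Mp Mm Mpn Mmn BAm Am0 Ap0 ABp hp hm.
have [wt [A [B [A0 AB hAB]]]] := ff.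
have B0 : 0 < B := lt_le_trans A0 AB.
have frame_le f : (frame_sum form J W v f <= (B * re_ip form J f f)%:E)%E.
  by rewrite -(normJ_sqr krein); case/andP: (hAB f).
have frame_ge f : ((A * re_ip form J f f)%:E <= frame_sum form J W v f)%E.
  by rewrite -(normJ_sqr krein); case/andP: (hAB f).
have sum_ge0 D f : (0 <= signed_frame_sum form J W v D f)%E.
  apply: esum_ge0 => i _; rewrite lee_fin mulr_ge0 ?sqr_ge0//.
  exact: Re_ge0.
(* The sum is nonnegative, so the upper bound fixes the sign of [f, f]: [Bp] is positive, and [Bm]
   below is negative. *)
have pos f : Mp f -> 0 <= sq form f.
  move=> /hp/andP[_ h]; have := le_trans (sum_ge0 _ _) h.
  by rewrite lee_fin pmulr_rge0// (lt_le_trans Ap0).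
have neg f : Mm f -> 0 <= -1 * sq form f.
  move=> /hm/andP[_ h]; have := le_trans (sum_ge0 _ _) h.
  by rewrite lee_fin nmulr_rge0 ?mulN1r ?oppr_ge0// (le_lt_trans BAm).
have [[al al0 alp] rp] : (exists2 al : R, 0 < al &
     forall f, Mp f -> al * re_ip form J f f <= 1 * sq form f) /\
     synthesis_range form J W v Ip = Mp.
  apply: (definite_family krein wt B0 frame_le (expr1n _ _) Ap0 Mpn) => f Mf.
    by rewrite mul1r; apply: pos.
  by rewrite mul1r; case/andP: (hp f Mf).
have [[be be0 bem] rm] : (exists2 be : R, 0 < be &
     forall f, Mm f -> be * re_ip form J f f <= -1 * sq form f) /\
     synthesis_range form J W v Im = Mm.
  (* With s = -1 the positive constant is - Am, as Am [f, f] = (- Am) (- [f, f]). *)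
  have Am0' : 0 < - Am by rewrite oppr_gt0.
  have s2 : (-1) ^+ 2 = 1 :> R by rewrite sqrrN expr1n.
  apply: (definite_family krein wt B0 frame_le s2 Am0' Mmn neg) => f Mf.
  by rewrite mulN1r mulrNN; case/andP: (hm f Mf).
have span := closed_sums_span krein wt B0 frame_le A0 frame_ge sgn.
split=> //.
- by split=> //; exists B => f; case/andP: (hAB f).
(* Each closed sum is maximal thanks to the uniform bound on the other one, here [be] on [Mm]. *)
- rewrite rp; apply: (@maximal_definite _ _ _ _ krein 1 be Mp Mm) be0 _ span.
  + exact: (closed_sum_subspace krein wt).
  + by exists al => // f Mf; rewrite (normJ_sqr krein) -[sq _ _]mul1r; apply: alp.
  + by move=> W' [ga ga0 h]; exists ga => // f Wf; rewrite mul1r; apply: h.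
  + by move=> f Mf; rewrite mul1r -mulN1r; apply: bem.
- rewrite rm; apply: (@maximal_definite _ _ _ _ krein (-1) al Mm Mp) al0 _ _.
  + exact: (closed_sum_subspace krein wt).
  + by exists be => // f Mf; rewrite (normJ_sqr krein) -mulN1r; apply: bem.
  + by move=> W' [ga ga0 h]; exists ga => // f Wf; rewrite mulN1r; apply: h.
  + by move=> f Mf; rewrite mulN1r opprK -[sq _ _]mul1r; apply: alp.
  + by move=> f; have [g [h [Mg Mh ->]]] := span f; exists h, g; rewrite addrC.
Qed.
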